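(* There is a constant $c=c(d)>0$, depending only on $d$, with the following property. Let $C\subset\mathbb{R}^d$ be a convex body and let $\mathcal{H}_C$ denote the family of all homothets of $C$. Then: (i) for every finite set $S\subset\mathbb{R}^d$ and every $\epsilon>0$, there is a set $W\subset\mathbb{R}^d$ with $|W|\le c/\epsilon$ such that $W\cap C'\neq\emptyset$ for every $C'\in\mathcal{H}_C$ with $|C'\cap S|\ge \epsilon|S|$ (i.e. $(S,\mathcal{H}_C|_S)$ admits a weak $\epsilon$-net of size $O_d(1/\epsilon)$); (ii) for every $C$-nice measure $\mu$ and every $\epsilon>0$, there is a set $W\subset\mathbb{R}^d$ with $|W|\le c/\epsilon$ such that $W\cap C'\neq\emptyset$ for every $C'\in\mathcal{H}_C$ with $\mu(C')\ge\epsilon\,\mu(\mathbb{R}^d)$.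
   Context: A convex body is a convex compact set with nonempty interior. A homothet of $C$ is a set $\lambda C+x=\{\lambda c+x: c\in C\}$ with $x\in\mathbb{R}^d$ and $\lambda>0$. All measures are Borel measures on $\mathbb{R}^d$ that are finite on compact sets. A measure $\mu$ is non-$C$-degenerate if it vanishes on the boundary of every homothet of $C$, and $C$-nice if it is finite ($\mu(\mathbb{R}^d)<\infty$), non-$C$-degenerate, and there is a ball $K$ with $\mu(K)=\mu(\mathbb{R}^d)$.
   Formalization: The finite set S is required to be nonempty and the measure μ to have μ(ℝ^d) ≠ 0, since for S = ∅ or μ = 0 every homothet meets the threshold and no W with |W| ≤ c/ε can hit all of them. *)

(* Defs.v *)
From HB Require Import structures.
From mathcomp Require Import all_boot all_order all_algebra.
From mathcomp Require Import all_classical all_reals all_analysis.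
From mathcomp Require Import finmap.
Set Implicit Arguments. Unset Strict Implicit. Unset Printing Implicit Defensive.
Import Order.TTheory GRing.Theory Num.Theory.
Import numFieldNormedType.Exports.
Local Open Scope classical_set_scope.
Local Open Scope ring_scope.

Definition Rd (R : realType) (d : nat) := 'rV[R]_d.

Definition convex_set (R : realType) (d : nat) (C : set 'rV[R]_d) : Prop :=
  forall x y, C x -> C y -> forall t : R, 0 <= t -> t <= 1 ->
    C ((1 - t) *: x + t *: y).

Definition convex_body (R : realType) (d : nat) (C : set 'rV[R]_d) : Prop :=
  [/\ convex_set C, compact C & interior C !=set0].

Definition homothet (R : realType) (d : nat) (C : set 'rV[R]_d) (lam : R)
  (x : 'rV[R]_d) : set 'rV[R]_d := [set lam *: c + x | c in C].

Definition is_homothet (R : realType) (d : nat) (C C' : set 'rV[R]_d) : Prop :=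
  exists lam : R, exists x : 'rV[R]_d, 0 < lam /\ C' = homothet C lam x.

Definition boundary (R : realType) (d : nat) (A : set 'rV[R]_d) : set 'rV[R]_d :=
  closure A `\` interior A.

Definition eball (R : realType) (d : nat) (x : 'rV[R]_d) (r : R) : set 'rV[R]_d :=
  [set y | \sum_(i < d) (y ord0 i - x ord0 i) ^+ 2 <= r ^+ 2].

Definition BorelRd (R : realType) (d : nat) :=
  g_sigma_algebraType (@open 'rV[R]_d).

Local Open Scope ereal_scope.

Definition locally_finite (R : realType) (d : nat)
  (mu : {measure set (BorelRd R d) -> \bar R}) : Prop :=
  forall K : set 'rV[R]_d, compact K -> mu K < +oo.

Definition non_C_degenerate (R : realType) (d : nat) (C : set 'rV[R]_d)
  (mu : {measure set (BorelRd R d) -> \bar R}) : Prop :=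
  forall C' : set 'rV[R]_d, is_homothet C C' -> mu (boundary C') = 0.

Definition C_nice (R : realType) (d : nat) (C : set 'rV[R]_d)
  (mu : {measure set (BorelRd R d) -> \bar R}) : Prop :=
  [/\ mu setT < +oo, non_C_degenerate C mu &
      exists (x : 'rV[R]_d) (r : R), (0 < r)%R /\ mu (eball x r) = mu setT].

(* Main.v *)
Require Import Defs.
From HB Require Import structures.
From mathcomp Require Import all_boot all_order all_algebra.
From mathcomp Require Import all_classical all_reals all_analysis.
From mathcomp Require Import finmap perm.
From mathcomp Require Import ring lra.
Set Implicit Arguments. Unset Strict Implicit. Unset Printing Implicit Defensive.
Import Order.TTheory GRing.Theory Num.Theory.
Import numFieldNormedType.Exports.
Local Open Scope classical_set_scope.
Local Open Scope ring_scope.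

(** For homothets of a fixed convex body, the piercing number of any family is at
    most a constant [N d] times its packing number.  Indeed a bounded number of
    points pierce all members meeting a member whose ratio is within a factor 2 of
    the smallest one (shrink each of them to half of that size towards a common
    point), and the members disjoint from it have a smaller packing number.
    Disjoint homothets of relative mass at least [eps] number at most [1 / eps]. *)

(** * Coordinate frames adapted to a convex body *)

Lemma convex_body_bounded (R : realType) (d : nat) (C : set 'rV[R]_d) :
  convex_body C -> exists2 B : R, 0 < B & forall c i, C c -> `|c ord0 i| <= B.
Proof.
move=> [_ /compact_bounded[B [_ HB]] _].
exists (Num.max B 0 + 1); first by rewrite ltr_pwDr// le_max lexx orbT.
move=> c i Cc; apply: (le_trans (y := `|c|)); last first.
  by apply: HB => //; rewrite (le_lt_trans (y := Num.max B 0)) ?ltrDl// le_max lexx.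
rewrite [leRHS]mx_normrE; exact: (le_bigmax _ (fun ij => `|c ij.1 ij.2|) (ord0, i)).
Qed.

(** Leibniz expansion, term by term. It makes the volumes spanned inside a bounded body bounded, so
    that they have a supremum. *)
Lemma det_le (R : realType) (n : nat) (M : 'M[R]_n) (B : R) :
  (forall i j, `|M i j| <= B) -> `|\det M| <= #|'S_n|%:R * B ^+ n.
Proof.
move=> MB; apply: (le_trans (ler_norm_sum _ _ _)).
rewrite (le_trans (y := \sum_(s : 'S_n) B ^+ n))//; last first.
  by rewrite sumr_const mulr_natl.
apply: ler_sum => s _; rewrite normrM normrX normrN1 expr1n mul1r normr_prod.
rewrite -[leRHS](_ : \prod_(i < n) B = _); last by rewrite prodr_const card_ord.
by apply: ler_prod => i _; rewrite normr_ge0 MB.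
Qed.

(* The weights are dyadic so that each induction step only takes a midpoint. *)
Lemma convex_frame_cube (R : realType) (d : nat) (C : set 'rV[R]_d) (v : 'rV[R]_d)
    (M : 'M[R]_d) : Defs.convex_set C -> C v -> (forall i, C (v + row i M)) ->
  forall s : 'rV[R]_d, (forall i, 0 <= s ord0 i <= 2^-1 ^+ d) -> C (v + s *m M).
Proof.
move=> convC Cv CM s Hs; rewrite mulmx_sum_row.
(* Induction on a list of indices. The sum over [a :: r] is the midpoint of
   [v + (2 * t a) *: row a M] and the point given by the doubled weights on [r], hence one factor
   1/2 per index. *)
have key (r : seq 'I_d) : forall t : 'I_d -> R,
    (forall i, 0 <= t i <= 2^-1 ^+ size r) -> C (v + \sum_(i <- r) t i *: row i M).
  elim: r => [|a r IH] t Ht; first by rewrite big_nil addr0.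
  have Ht2 i : 0 <= 2 * t i <= 2^-1 ^+ size r.
    by move: (Ht i); rewrite /= exprS; lra.
  have Ca : C (v + (2 * t a) *: row a M).
    rewrite (_ : v + _ = (1 - 2 * t a) *: v + (2 * t a) *: (v + row a M)).
      have /andP[ta0 ta1] := Ht2 a.
      apply: convC => //.
      apply: (le_trans ta1).
      by rewrite exprn_ile1// ?invr_ge0// invf_le1// ler1n.
    by apply/rowP => i; rewrite !mxE; ring.
  have := convC _ _ Ca (IH _ Ht2) 2^-1.
  rewrite big_cons -[X in C X](_ : v + (t a *: row a M + \sum_(i <- r) t i *: row i M) = _).
    by apply; lra.
  rewrite (_ : \sum_(i <- r) (2 * t i) *: row i M = 2 *: \sum_(i <- r) t i *: row i M).
    by apply/rowP => i; rewrite !mxE; field.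
  by rewrite scaler_sumr; apply: eq_bigr => i _; rewrite scalerA.
by apply: key => i; rewrite -[index_enum _]enumT size_enum_ord.
Qed.

(** Expand the right-hand determinant along row [i]: its cofactors are those of [M], since they
    ignore the replaced row. *)
Lemma cramer_row (R : realType) (d : nat) (M : 'M[R]_d) (u : 'rV[R]_d) (i : 'I_d) :
  M \in unitmx ->
  (u *m invmx M) ord0 i * \det M = \det (\matrix_k (if k == i then u else row k M)).
Proof.
move=> uM; rewrite /invmx uM -scalemxAr mxE mulrC mulrA mulrV ?mul1r; last first.
  by rewrite -unitmxE.
rewrite (expand_det_row _ i) mxE; apply: eq_bigr => j _.
rewrite !mxE eqxx; congr (_ * _); rewrite /cofactor; congr (_ * \det _).
by apply/matrixP => a b; rewrite !mxE eq_sym (negbTE (neq_lift _ _)) mxE.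
Qed.

(* Take the vectors spanning an almost maximal volume: by Cramer's rule the
   coordinates of [c - v] are ratios of such volumes. *)
Lemma convex_body_frame (R : realType) (d : nat) (C : set 'rV[R]_d) :
  convex_body C -> exists (v : 'rV[R]_d) (M : 'M[R]_d),
    [/\ C v, forall i, C (v + row i M) &
      forall c, C c -> exists2 t : 'rV[R]_d,
        c = v + t *m M & forall i, `|t ord0 i| <= 2].
Proof.
move=> bC; have [B B0 CB] := convex_body_bounded bC; case: bC => _ _ [p pC].
pose frame (v : 'rV[R]_d) (M : 'M[R]_d) := C v /\ forall i, C (v + row i M).
pose E := [set r : R | exists v M, frame v M /\ r = `|\det M|].
have ubE : ubound E (#|'S_d|%:R * (B + B) ^+ d).
  move=> _ [v [M [[Cv CM] ->]]]; apply: det_le => i j.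
  rewrite (_ : M i j = (v + row i M) ord0 j - v ord0 j); last by rewrite !mxE; ring.
  by rewrite (le_trans (ler_normB _ _))// lerD// CB.
(* A small multiple of the standard basis at an interior point spans a positive volume. *)
have [r r0 rE] : exists2 r : R, 0 < r & E r.
  move: pC; rewrite /interior/= -nbhs_ballE => -[e /= e0 pe].
  exists (`|\det ((e / 2)%:M : 'M[R]_d)|).
    by rewrite det_scalar normr_gt0 expf_neq0// lt0r_neq0// divr_gt0.
  exists p, (e / 2)%:M; split => //; split; first exact/pe/ballxx.
  move=> i; apply: pe; split => // k j; rewrite /ball/= !mxE.
  rewrite ord1 opprD addrA subrr sub0r normrN normrMn ger0_norm ?divr_ge0 ?ltW//.
  case: (i == j) => /=; rewrite ?mulr1n ?mulr0n//; lra.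
have hE : has_sup E by split; [exists r|eexists; exact: ubE].
have supE0 : 0 < sup E by apply: (lt_le_trans r0); exact: ub_le_sup (proj2 hE) _ rE.
(* A volume above half the supremum suffices; this is where the coordinate bound 2 comes from. *)
have [_ [v [M [[Cv CM] ->]]] Msup] := sup_adherent (divr_gt0 supE0 (ltr0n R 2)) hE.
have dM0 : 0 < `|\det M| by lra.
have uM : M \in unitmx by rewrite unitmxE unitfE -normr_gt0.
exists v, M; split => // c Cc; exists ((c - v) *m invmx M).
  by rewrite mulmxKV// addrC subrK.
move=> i; rewrite -(ler_pM2r dM0) -normrM cramer_row//.
apply: (@le_trans _ _ (sup E)); last lra.
apply: ub_le_sup; first exact: (proj2 hE).
eexists v, _; split; last by [].
split => // k; rewrite rowK; case: eqP => // _.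
by rewrite addrC subrK.
Qed.

(** * Piercing the large homothets that meet a given one *)

(** Size of a grid of mesh [1 / 2 ^ d.+1] covering [-3, 3] in each of [d] coordinates; the extra 2
    accounts for both endpoints and for rounding up. *)
Definition piercing_bound (d : nat) : nat := ((6 * 2 ^ d.+1).+2 ^ d)%N.

(* In the coordinates of [convex_body_frame], a homothet at least half as large
   as [h] and meeting it contains an axis-parallel cube of side [2^-d.+1], which
   contains a point of the grid [P]. *)
Lemma pierce_meeting_homothets (R : realType) (d : nat) (C : set 'rV[R]_d)
    (lam0 : R) (x0 : 'rV[R]_d) : convex_body C -> 0 < lam0 ->
  exists2 P : seq 'rV[R]_d, size P = piercing_bound d &
    forall lam x, lam0 / 2 <= lam ->
      homothet C lam0 x0 `&` homothet C lam x !=set0 ->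
      exists2 p, p \in P & homothet C lam x p.
Proof.
move=> bC lam0_gt0; have [v [M [Cv CM Ct]]] := convex_body_frame bC.
have [convC _ _] := bC.
pose L : R := 2 ^+ d.+1; have L0 : 0 < L by rewrite exprn_gt0.
pose g (f : {ffun 'I_d -> 'I_(6 * 2 ^ d.+1).+2}) : 'rV[R]_d :=
  \row_i (((f i)%:R - 3 * L) / L).
exists [seq lam0 *: (v + g f *m M) + x0 | f : {ffun 'I_d -> 'I_(6 * 2 ^ d.+1).+2}].
  by rewrite size_image card_ffun !card_ord.
move=> lam x le_lam [_ [[c0 Cc0 <-] [c Cc eq_q]]].
have lam_gt0 : 0 < lam by lra.
have [t0 ec0 t0_le] := Ct _ Cc0; have [t ec t_le] := Ct _ Cc.
(* Position, in grid units, of the corner of the cube. It lies in [0, 6L] because [t0] and [t] have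
   entries in [-2, 2]. Rounding it up to [f] moves it by at most one unit, so the offset [s] is at
   most [2 / L], that is [2^-1 ^+ d]. *)
pose y i := L * (t0 ord0 i - t ord0 i / 2) + 3 * L.
have y_ge0 i : 0 <= y i.
  have /ler_normlP [] := t0_le i; have /ler_normlP [] := t_le i.
  rewrite /y; nra.
have y_le i : y i <= 6 * L.
  have /ler_normlP [] := t0_le i; have /ler_normlP [] := t_le i.
  rewrite /y; nra.
pose f := [ffun i => inord (Num.truncn (y i)).+1 : 'I_(6 * 2 ^ d.+1).+2].
have fE i : (f i : nat) = (Num.truncn (y i)).+1.
  rewrite ffunE inordK// ltnS truncn_lt_nat//.
  by rewrite (le_lt_trans (y_le i))// -[ltRHS]natr1 natrM natrX ltrDl.
pose s : 'rV[R]_d := \row_i (2 * ((f i)%:R - y i) / L).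
have s_le i : 0 <= s ord0 i <= 2^-1 ^+ d.
  have /andP[y1 y2] := truncn_itv (y_ge0 i).
  rewrite mxE fE; apply/andP; split.
    by rewrite divr_ge0 ?(ltW L0)// mulr_ge0// subr_ge0 ltW.
  rewrite ler_pdivrMr// exprVn /L exprS mulrCA mulVf ?expf_neq0//.
  by rewrite mulr1; rewrite -natr1 in y2 *; lra.
have gE : g f = t0 - 2^-1 *: t + 2^-1 *: s.
  apply/rowP => i; rewrite !mxE /y; field; exact: lt0r_neq0.
exists (lam0 *: (v + g f *m M) + x0); first by apply/map_f/mem_enum.
(* Shrinking by [k] about [c] replaces ratio [lam] by [lam0 / 2] and fixes the common point;
   convexity keeps the result inside since [k <= 1]. *)
pose k := lam0 / 2 / lam.
exists ((1 - k) *: c + k *: (v + s *m M)).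
  apply: (convC) => //; first exact: convex_frame_cube convC Cv CM _ s_le.
    by rewrite /k !divr_ge0 ?(ltW lam0_gt0) ?(ltW lam_gt0).
  by rewrite /k ler_pdivrMr// mul1r.
have -> : x = lam0 *: c0 + x0 - lam *: c by rewrite -eq_q addrC addKr.
rewrite gE ec ec0 mulmxDl mulmxBl -!scalemxAl.
by apply/rowP => i; rewrite !mxE /k; field; exact: lt0r_neq0.
Qed.

(** * Compactness and accumulation of small homothets *)

Lemma continuous_homothety (R : realType) (V : normedModType R) (lam : R) (x : V) :
  continuous (fun c : V => lam *: c + x).
Proof. by move=> c; apply: cvgD; [exact: scaler_continuous|exact: cvg_cst]. Qed.

Lemma homothet_compact (R : realType) (d : nat) (C : set 'rV[R]_d) lam x :
  compact C -> compact (homothet C lam x).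
Proof.
move=> cC; apply: continuous_compact => //; apply: continuous_subspaceT.
exact: (@continuous_homothety R 'rV[R]_d).
Qed.

(** Otherwise each point of [K] has a neighbourhood containing no member. A small member passing
    close to the point would lie in it, and compactness of [K] makes the forbidden ratios
    uniform. *)
Lemma shrinking_homothets_cluster (R : realType) (d : nat) (C K : set 'rV[R]_d)
    (H : set (R * 'rV[R]_d)) : convex_body C -> compact K ->
  (forall h, H h -> 0 < h.1) ->
  (forall e, 0 < e -> exists h, [/\ H h, h.1 < e &
     homothet C h.1 h.2 `&` K !=set0]) ->
  exists p : 'rV[R]_d, forall U, nbhs p U ->
    exists2 h, H h & homothet C h.1 h.2 `<=` U.
Proof.
move=> bC cK H_gt0 small; apply: contrapT => /forallNP noP.
have [B B0 CB] := convex_body_bounded bC.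
pose avoids (e : R) x := forall h, H h -> h.1 < e -> ~ homothet C h.1 h.2 x.
have near0 : \forall e \near 0^'+, K `<=` avoids e.
  apply: (iffLR (compact_near_coveringP K)) => // p Kp.
  have /existsNP[U /not_implyP[pU noU]] := noP p.
  move: pU; rewrite -nbhs_ballE => -[e /= e0 peU].
  near=> q lam => -[mu x] Hmux /= mu_lt [c Cc cE]; apply: noU.
  exists (mu, x) => //= _ [c' Cc' <-]; apply: peU.
  have mu0 := H_gt0 _ Hmux; rewrite /= in mu0.
  (* Coordinates of two points of the member differ by at most [2 * mu * B], which is then below
     [e / 2]; the other half is the distance from [p] to [q]. *)
  have e4 : mu * (4 * B) < e.
    have : lam < e / (4 * B).
      by near: lam; apply: nbhs_right_lt; rewrite divr_gt0// mulr_gt0.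
    by rewrite ltr_pdivlMr ?mulr_gt0//; apply/le_lt_trans/ler_wpM2r; nra.
  have [_ pq] : ball p (e / 2) q by near: q; apply: nbhsx_ballx; rewrite divr_gt0.
  split => // i j; move: (pq i j); rewrite /ball /= -cE !ord1 !mxE => pqj.
  have /ler_normlP [] := CB c j Cc; have /ler_normlP [] := CB c' j Cc'.
  move: pqj; rewrite !ltr_norml; nra.
have [e e0 He] : exists2 e, 0 < e & K `<=` avoids e.
  by near (0 : R)^'+ => e; exists e; last by near: e.
have [h [Hh he [x [hx Kx]]]] := small e e0.
exact: He Kx _ Hh he hx.
Unshelve. all: by end_near. Qed.

(** * Packing and piercing numbers *)

(** Homothets are given by pairs (ratio, translation), so that ratios can be compared; the relation
    is boolean for use with [pairwise]. *)
Definition disjoint_homothets (R : realType) (d : nat) (C : set 'rV[R]_d) :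
    rel (R * 'rV[R]_d) :=
  [rel h g | `[< homothet C h.1 h.2 `&` homothet C g.1 g.2 = set0 >]].

Definition packing (R : realType) (d : nat) (C : set 'rV[R]_d)
    (H : set (R * 'rV[R]_d)) (s : seq (R * 'rV[R]_d)) : Prop :=
  (forall h, h \in s -> H h) /\ pairwise (disjoint_homothets C) s.

Definition homothet_union (R : realType) (d : nat) (C : set 'rV[R]_d)
    (s : seq (R * 'rV[R]_d)) : set 'rV[R]_d :=
  \big[setU/set0]_(h <- s) homothet C h.1 h.2.

Lemma in_homothet_union (R : realType) (d : nat) (C : set 'rV[R]_d) s x :
  homothet_union C s x <-> exists2 h, h \in s & homothet C h.1 h.2 x.
Proof. by rewrite /homothet_union -bigcup_seq. Qed.

Lemma homothet_union_compact (R : realType) (d : nat) (C : set 'rV[R]_d) s :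
  compact C -> compact (homothet_union C s).
Proof. by move=> cC; apply: bigsetU_compact => h _; exact: homothet_compact. Qed.

Lemma packing_cons (R : realType) (d : nat) (C : set 'rV[R]_d) H h s :
  packing C H (h :: s) <->
  [/\ H h, homothet C h.1 h.2 `&` homothet_union C s = set0 & packing C H s].
Proof.
rewrite /packing pairwise_cons; split.
  move=> [Hhs /andP[/allP hs ds]]; split; first exact/Hhs/mem_head.
    apply/seteqP; split => // x [hx /in_homothet_union[g gs gx]].
    by have /asboolP <- := hs g gs.
  by split => // g gs; apply: Hhs; rewrite inE gs orbT.
move=> [Hh hs0 [Hs ds]]; split.
  by move=> g; rewrite inE => /predU1P[->//|]; exact: Hs.
rewrite ds andbT; apply/allP => g gs; apply/asboolP.
apply/seteqP; split => // x [hx gx]; rewrite -hs0; split => //.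
by apply/in_homothet_union; exists g.
Qed.

Lemma packing_sub (R : realType) (d : nat) (C : set 'rV[R]_d) (H G : set (R * 'rV[R]_d)) s :
  H `<=` G -> packing C H s -> packing C G s.
Proof. by move=> HG [Hs ds]; split => // h /Hs/HG. Qed.

(* Either the ratios in [H] are bounded below, and the members meeting an almost
   smallest one are pierced by boundedly many points, or arbitrarily small
   members accumulate at a point [p]; in both cases the remaining members admit
   no packing of size [n.+1]. *)
Lemma piercing_le_packing (R : realType) (d : nat) (C : set 'rV[R]_d) (n : nat)
    (H : set (R * 'rV[R]_d)) : convex_body C ->
  (forall h, H h -> 0 < h.1) ->
  (forall s, packing C H s -> (size s <= n)%N) ->
  exists2 W : seq 'rV[R]_d, (size W <= piercing_bound d * n)%N &
    forall h, H h -> exists2 w, w \in W & homothet C h.1 h.2 w.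
Proof.
move=> bC; have [_ cC _] := bC; have B_gt0 : (0 < piercing_bound d)%N.
  by rewrite expn_gt0.
have packing1 (G : set (R * 'rV[R]_d)) h s : G h -> packing C G s ->
    (forall x, homothet C h.1 h.2 x -> ~ homothet_union C s x) -> packing C G (h :: s).
  move=> Gh Gs hs; apply/packing_cons; split => //.
  by apply/seteqP; split => // x [hx sx]; exact: hs hx sx.
elim: n H => [|n IH] H H_gt0 Hn.
  exists [::] => // h Hh; suff /Hn : packing C H [:: h] by [].
  apply: packing1 => //; rewrite /homothet_union.
  by move=> x _; rewrite big_nil.
have [Hsmall|] := pselect (forall s, packing C H s -> (size s <= n)%N).
  have [W Wn HW] := IH H H_gt0 Hsmall; exists W => //.
  by rewrite (leq_trans Wn)// leq_mul2l leqnSn orbT.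
move=> /existsNP[s0 /not_implyP[s0H /negP]]; rewrite -ltnNge => s0n.
have [[m m0 Hm]|Hinf] := pselect (exists2 m, 0 < m & forall h, H h -> m <= h.1).
  pose E := [set h.1 | h in H].
  have hE : has_inf E.
    split; last by exists m => _ [h Hh <-]; exact: Hm.
    by case: s0 s0H s0n => // h s [/(_ h (mem_head _ _)) Hh _] _; exists h.1, h.
  have iE : 0 < inf E.
    by apply: (lt_le_trans m0); apply: lb_le_inf (proj1 hE) _ => _ [h Hh <-]; exact: Hm.
  (* With the infimum itself as tolerance, the ratio of [h0] is less than twice any ratio in [H]. *)
  have [_ [h0 Hh0 <-] h0E] := inf_adherent iE hE.
  have [P szP HP] := pierce_meeting_homothets h0.2 bC (H_gt0 _ Hh0).
  pose G := [set h | H h /\ homothet C h0.1 h0.2 `&` homothet C h.1 h.2 = set0].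
  have [||W Wn HW] := IH G; first by move=> h [/H_gt0].
    move=> s Gs; rewrite -ltnS; apply: (Hn (h0 :: s)); apply: packing1 => //.
      by apply: packing_sub Gs => h [].
    move=> x h0x /in_homothet_union[h hs hx].
    by have [_ G0] := proj1 Gs h hs; rewrite -[False]/(set0 x) -G0.
  exists (P ++ W); first by rewrite size_cat szP mulnS leq_add2l.
  move=> h Hh; have [h0h|] := pselect (homothet C h0.1 h0.2 `&` homothet C h.1 h.2 = set0).
    by have [w wW hw] := HW h (conj Hh h0h); exists w => //; rewrite mem_cat wW orbT.
  move=> /eqP/set0P/(HP _ _ _)[|w wP hw].
    have := ge_inf (proj2 hE) (imageP _ Hh : E h.1); lra.
  by exists w => //; rewrite mem_cat wP.
(* The packing [s0] has the maximal size [n.+1], so every member meets its union, a compact set. *)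
have [||p Hp] := @shrinking_homothets_cluster _ _ C (homothet_union C s0) H bC _ H_gt0.
- exact: homothet_union_compact.
- move=> e e0; apply: contrapT => noh; apply: Hinf; exists e => // h Hh.
  rewrite leNgt; apply/negP => he; apply: noh; exists h; split => //.
  apply: contrapT => hs0.
  have /Hn : packing C H (h :: s0).
    by apply: packing1 => // x hx s0x; apply: hs0; exists x.
  by rewrite /= ltnNge s0n.
pose G := [set h | H h /\ ~ homothet C h.1 h.2 p].
have [||W Wn HW] := IH G; first by move=> h [/H_gt0].
  (* The union of [s] is closed and misses [p], so some member near [p] is disjoint from it and
     extends [s]. *)
  move=> s Gs; have [|h Hh hs] := Hp (~` homothet_union C s).
    apply: open_nbhs_nbhs; split.
      rewrite openC; apply: compact_closed; first exact: norm_hausdorff.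
      exact: homothet_union_compact.
    by move=> /in_homothet_union[h hs hp]; have [] := proj1 Gs h hs.
  rewrite -ltnS; apply: (Hn (h :: s)); apply: packing1 => //.
  by apply: packing_sub Gs => ? [].
exists (p :: W); first by rewrite /= mulnS -add1n leq_add.
move=> h Hh; have [hp|hp] := pselect (homothet C h.1 h.2 p).
  by exists p => //; exact: mem_head.
by have [w wW hw] := HW h (conj Hh hp); exists w => //; rewrite inE wW orbT.
Qed.

(** * From packing numbers to weak nets *)

Lemma packing_superadditive (R : realType) (d : nat) (C : set 'rV[R]_d)
    (f : set 'rV[R]_d -> R) (a : R) : compact C -> 0 <= f set0 ->
  (forall A B, compact A -> compact B -> A `&` B = set0 -> f A + f B <= f (A `|` B)) ->
  forall s, packing C [set h | a <= f (homothet C h.1 h.2)] s ->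
  (size s)%:R * a <= f (homothet_union C s).
Proof.
move=> cC f0 fU; elim=> [|h s IH]; first by rewrite mul0r /homothet_union big_nil.
move=> /packing_cons[/= ah hs0 /IH ?].
rewrite /homothet_union big_cons -/(homothet_union C s) -natr1 mulrDl mul1r addrC.
apply: le_trans (fU _ _ _ _ hs0); first exact: lerD.
- exact: homothet_compact.
- exact: homothet_union_compact.
Qed.

(** Common form of the counting and the measure statement: [f] is the mass and [T] a bound on it.
    Superadditivity on compact sets is enough, because finite unions of homothets are compact. *)
Lemma weak_net_superadditive (R : realType) (d : nat) (C : set 'rV[R]_d)
    (f : set 'rV[R]_d -> R) (T eps : R) : convex_body C -> 0 < eps -> 0 < T ->
  0 <= f set0 -> (forall A, compact A -> f A <= T) ->
  (forall A B, compact A -> compact B -> A `&` B = set0 -> f A + f B <= f (A `|` B)) ->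
  exists W : {fset 'rV[R]_d}, (#|` W|)%:R <= (piercing_bound d)%:R / eps /\
    forall C', is_homothet C C' -> eps * T <= f C' -> exists2 w, w \in W & C' w.
Proof.
move=> bC eps0 T0 f0 fT fU; have [_ cC _] := bC.
have ieps0 : 0 <= eps^-1 by rewrite invr_ge0 ltW.
pose H := [set h : R * 'rV[R]_d | 0 < h.1 /\ eps * T <= f (homothet C h.1 h.2)].
(* A packing of [k] heavy members has mass at least [k * eps * T], at most [T]; so [k] is at most
   the integer part of [eps^-1]. *)
have [||W szW HW] := @piercing_le_packing _ _ C (Num.truncn eps^-1) H bC.
- by move=> h [].
- move=> s Hs; rewrite truncn_ge_nat// -(ler_pM2r (mulr_gt0 eps0 T0)).
  rewrite [leRHS]mulrA mulVf ?gt_eqF// mul1r.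
  apply: (@le_trans _ _ (f (homothet_union C s))); last exact/fT/homothet_union_compact.
  by apply: packing_superadditive => //; apply: packing_sub Hs => h [].
exists [fset w in W]%fset; split; last first.
  move=> _ [lam [x [lam0 ->]]] heavy.
  by have [w wW hw] := HW (lam, x) (conj lam0 heavy); exists w; rewrite ?inE.
apply: (@le_trans _ _ (size W)%:R).
  by rewrite ler_nat card_fseq size_undup.
apply: (@le_trans _ _ (piercing_bound d * Num.truncn eps^-1)%:R); first by rewrite ler_nat.
by rewrite natrM ler_wpM2l// truncn_le.
Qed.

Lemma compact_measurable_BorelRd (R : realType) (d : nat) (A : set 'rV[R]_d) :
  compact A -> measurable (A : set (BorelRd R d)).
Proof.
move=> cA; rewrite -[A]setCK; apply: measurableC; apply: sub_sigma_algebra.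
by rewrite openC; apply: compact_closed => //; exact: norm_hausdorff.
Qed.

Local Open Scope fset_scope.
Local Open Scope ring_scope.

Theorem mainTheorem1 (d : nat) (R : realType) :
  exists c : R, 0 < c /\
  forall C : set 'rV[R]_d, convex_body C ->
  (forall (S : {fset 'rV[R]_d}) (eps : R), S != fset0 -> 0 < eps ->
     exists W : {fset 'rV[R]_d}, (#|` W|%:R <= c / eps) /\
       forall C' : set 'rV[R]_d, is_homothet C C' ->
         eps * #|` S|%:R <= #|` [fset x in S | `[< C' x >]] |%:R ->
         exists2 w, w \in W & C' w) /\
  (forall (mu : {measure set (BorelRd R d) -> \bar R}) (eps : R),
     locally_finite mu -> C_nice C mu -> (mu setT != 0)%E -> 0 < eps ->
     exists W : {fset 'rV[R]_d}, (#|` W|%:R <= c / eps) /\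
       forall C' : set 'rV[R]_d, is_homothet C C' ->
         (eps%:E * mu setT <= mu C')%E ->
         exists2 w, w \in W & C' w).
Proof.
exists (piercing_bound d)%:R; split; first by rewrite ltr0n expn_gt0.
move=> C bC; have [_ cC _] := bC; split.
  move=> S eps S0 eps0.
  pose f (A : set 'rV[R]_d) : R := #|` [fset x in S | `[< A x >]] |%:R.
  have [||||W [szW HW]] := @weak_net_superadditive _ _ C f #|` S|%:R eps bC eps0.
  - by rewrite ltr0n cardfs_gt0.
  - exact: ler0n.
  - by move=> A _; rewrite ler_nat fsubset_leq_card// fset_sub.
  - move=> A B _ _ AB0; rewrite -natrD ler_nat -cardfsUI.
    (* The traces of [A] and [B] on [S] are disjoint, so their cardinals add up. *)
    rewrite (_ : _ `&` _ = fset0) ?cardfs0 ?addn0.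
      apply: fsubset_leq_card; apply/fsubsetP => x; rewrite !inE.
      by move=> /orP[/andP[-> /asboolP Ax]|/andP[-> /asboolP Bx]];
        apply/asboolP; [left|right].
    apply/fsetP => x; rewrite !inE; apply/negbTE/negP.
    move=> /andP[/andP[_ /asboolP Ax] /andP[_ /asboolP Bx]].
    by rewrite -[False]/(@set0 'rV[R]_d x) -AB0.
  by exists W.
move=> mu eps _ [muT _ _] muT0 eps0.
have le_muT A : compact A -> (mu A <= mu setT)%E.
  move=> /compact_measurable_BorelRd mA.
  by apply: le_measure; [exact: mem_set|exact/mem_set/measurableT|exact: subsetT].
have fin A : compact A -> mu A \is a fin_num.
  by move=> /le_muT leA; rewrite ge0_fin_numE//; exact: le_lt_trans muT.
have finT : mu setT \is a fin_num by rewrite ge0_fin_numE.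
(* [fine] sends infinite values to 0, but it is only evaluated at sets of finite measure: compact
   sets and the whole space. *)
pose f (A : set 'rV[R]_d) : R := fine (mu A).
have [||||W [szW HW]] := @weak_net_superadditive _ _ C f (fine (mu setT)) eps bC eps0.
- by rewrite fine_gt0// muT andbT lt0e muT0 measure_ge0.
- by rewrite /f measure0.
- by move=> A cA; apply: fine_le; [exact: fin|exact: finT|exact: le_muT].
- move=> A B cA cB AB0; rewrite /f -fineD ?fin// measureU//;
    exact: compact_measurable_BorelRd.
exists W; split => // C' hC' heavy; apply: HW => //.
rewrite -lee_fin EFinM /f !fineK//.
by case: hC' => lam [x [_ ->]]; apply/fin/homothet_compact.
Qed.
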